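(* Let $X$ be an extended metric space, let $\ell\in[0,\infty)$, and put $PH_n(X)(\ell^-)=\operatorname{colim}_{\ell'<\ell}PH_n(X)(\ell')$ (colimit over $\ell'\in[0,\ell)$ along the transition maps; it is $0$ for $\ell=0$). There is a long exact sequence of abelian groups $$\cdots\xrightarrow{\partial_{n+1,\ell}}PH_n(X)(\ell^-)\xrightarrow{\tau_{n,\ell}}PH_n(X)(\ell)\xrightarrow{\rho_{n,\ell}}MH_{n,\ell}(X)\xrightarrow{\partial_{n,\ell}}PH_{n-1}(X)(\ell^-)\xrightarrow{\tau_{n-1,\ell}}PH_{n-1}(X)(\ell)\xrightarrow{\rho_{n-1,\ell}}\cdots,$$ natural in $X$ with respect to nonexpansive maps, in which $\tau_{n,\ell}$ is the transition map of the persistence module (the map induced on the colimit by the transition maps $PH_n(X)(\ell')\to PH_n(X)(\ell)$, $\ell'<\ell$), $\rho_{n,\ell}$ is induced by the quotient map $F_\ell C_\bullet(X)\to MC_{\bullet,\ell}(X)$ onto the associated graded, and $\partial_{n,\ell}$ is the connecting homomorphism of the short exact sequence of complexes $0\to F_{<\ell}C_\bullet(X)\to F_\ell C_\bullet(X)\to MC_{\bullet,\ell}(X)\to 0$.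
   Context: An extended metric space $X$ is a set $\mathrm{Ob}\,X$ with $d\colon \mathrm{Ob}\,X\times \mathrm{Ob}\,X\to[0,\infty]$ such that $d(x,x)=0$, $d(x,y)=d(y,x)$, $d(x,z)\le d(x,y)+d(y,z)$, and $d(x,y)=0$ implies $x=y$. These are the objects of the category $\mathsf{Met}$, whose morphisms are the nonexpansive maps ($d(fx,fx')\le d(x,x')$). The length nerve $N(X)$ is the simplicial set with $N(X)_n$ the set of all maps $[n]\to\mathrm{Ob}\,X$, written $\mathbf{x}=\langle x_0,\dots,x_n\rangle$; simplicial operators act by precomposition, so the face $d_i$ deletes the entry $x_i$ and the degeneracy $s_i$ repeats it. The length is $\lambda\mathbf{x}=\sum_{i=1}^n d(x_{i-1},x_i)\in[0,\infty]$. The normalised chain complex $C_\bullet(X)$ has $C_n(X)=\mathbb{Z}[N(X)_n]/D_n(X)$, with $D_n(X)$ spanned by the degenerate simplices and differential $\partial=\sum_{i=0}^n(-1)^i d_i$; $C_n(X)$ is free on the nondegenerate tuples, i.e. those with $x_{i-1}\ne x_i$ for $1\le i\le n$. For $\ell\in[0,\infty)$, $F_\ell C_n(X)\subseteq C_n(X)$ is the subgroup spanned by the nondegenerate tuples with $\lambda\mathbf{x}\le\ell$; these form subcomplexes increasing in $\ell$. Persistent magnitude homology is the functor $PH_n(X)\colon([0,\infty),\le)\to\mathsf{Ab}$, $\ell\mapsto H_n(F_\ell C_\bullet(X))$, with transition maps induced by the inclusions $F_\ell C_\bullet(X)\subseteq F_{\ell'}C_\bullet(X)$, $\ell\le\ell'$.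 Put $F_{<\ell}C_\bullet(X)=\bigcup_{\ell'<\ell}F_{\ell'}C_\bullet(X)$ (zero for $\ell=0$), $MC_{\bullet,\ell}(X)=F_\ell C_\bullet(X)/F_{<\ell}C_\bullet(X)$ and $MH_{n,\ell}(X)=H_n(MC_{\bullet,\ell}(X))$ (magnitude homology). A nonexpansive $F\colon X\to Y$ with underlying map $f$ induces the chain map $\langle x_0,\dots,x_n\rangle\mapsto\langle fx_0,\dots,fx_n\rangle$, which preserves all filtration stages, and thereby maps on all the groups above. *)

(* Defs.v *)
From HB Require Import structures.
From mathcomp Require Import freeg.
From mathcomp Require Import all_boot all_order all_algebra.
From mathcomp Require Import generic_quotient ring_quotient.
From mathcomp Require Import boolp classical_sets reals constructive_ereal.
From mathcomp Require Import interval_inference zify.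

Set Implicit Arguments.
Unset Strict Implicit.
Unset Printing Implicit Defensive.

Import Order.TTheory GRing.Theory Num.Theory.

Local Open Scope ring_scope.
Local Open Scope quotient_scope.

Section Subgroup.
Variables (V : zmodType) (S : zmodClosed V).

Record subgroup := Subgroup { sgval : V; sgvalP : sgval \in S }.

HB.instance Definition _ := [isSub for sgval].
HB.instance Definition _ := [Choice of subgroup by <:].
HB.instance Definition _ := [SubChoice_isSubZmodule of subgroup by <:].

Lemma sgval_is_additive : zmod_morphism sgval.
Proof. by move=> x y. Qed.
HB.instance Definition _ :=
  GRing.isZmodMorphism.Build subgroup V sgval sgval_is_additive.

End Subgroup.

Section SubgroupMap.
Variables (V W : zmodType) (f : {additive V -> W}).
Variables (S : zmodClosed V) (T : zmodClosed W).
Hypothesis fST : forall x, x \in S -> f x \in T.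

Definition subgroup_map (x : subgroup S) : subgroup T :=
  Subgroup (fST (sgvalP x)).

Lemma subgroup_map_is_additive : zmod_morphism subgroup_map.
Proof. by move=> x y; apply: val_inj; rewrite /= raddfB. Qed.
HB.instance Definition _ :=
  GRing.isZmodMorphism.Build (subgroup S) (subgroup T) subgroup_map
    subgroup_map_is_additive.

End SubgroupMap.

Section Preimage.
Variables (V W : zmodType) (f : {additive V -> W}) (T : zmodClosed W).

Definition preim_pred : {pred V} := fun x => f x \in T.

Lemma preim_zmod_closed : zmod_closed preim_pred.
Proof.
split=> [|x y]; rewrite /in_mem /= /preim_pred ?raddf0 ?rpred0 //.
by move=> fx fy; rewrite raddfB rpredB.
Qed.
HB.instance Definition _ :=
  GRing.isZmodClosed.Build V preim_pred preim_zmod_closed.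

End Preimage.

Section Quotient.
Variables (V : zmodType) (S : zmodClosed V).

Definition quotient : zmodType := Quotient.quot S.
Definition qproj : {additive V -> quotient} := \pi_(Quotient.quot S).

Lemma qproj_surj (x : quotient) : exists y, qproj y = x.
Proof. by exists (repr x); rewrite /qproj /= reprK. Qed.

Lemma qproj_eq (x y : V) : qproj x = qproj y <-> x - y \in S.
Proof. by rewrite Quotient.idealrBE; split=> [/eqP|/eqP]. Qed.

Lemma qproj_eq0 (x : V) : qproj x = 0 <-> x \in S.
Proof. by rewrite -(raddf0 qproj) qproj_eq subr0. Qed.

End Quotient.

Arguments qproj : simpl never.
Arguments qproj {V} S.

Section QuotLift.
Variables (V W : zmodType) (f : {additive V -> W}) (S : zmodClosed V).

Definition quot_lift_fun (fS : forall x, x \in S -> f x = 0) (x : quotient S) : W :=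
  f (repr (x : Quotient.quot S)).

Hypothesis fS : forall x, x \in S -> f x = 0.

Lemma quot_lift_funE x : quot_lift_fun fS (qproj S x) = f x.
Proof.
apply/eqP; rewrite -subr_eq0 -raddfB; apply/eqP/fS.
by apply/qproj_eq; rewrite /qproj /= reprK.
Qed.

Lemma quot_lift_is_additive : zmod_morphism (quot_lift_fun fS).
Proof.
move=> x y; have [x' <-] := qproj_surj x; have [y' <-] := qproj_surj y.
by rewrite -raddfB !quot_lift_funE raddfB.
Qed.
HB.instance Definition _ :=
  GRing.isZmodMorphism.Build (quotient S) W (quot_lift_fun fS) quot_lift_is_additive.

Definition quot_lift : {additive quotient S -> W} := quot_lift_fun fS.

Lemma quot_liftE x : quot_lift (qproj S x) = f x.
Proof. exact: quot_lift_funE. Qed.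

End QuotLift.

Arguments quot_lift : simpl never.
Arguments quot_lift {V W f S} fS.
Arguments quot_liftE {V W f S} fS x.

Section QuotMap.
Variables (V W : zmodType) (f : {additive V -> W}).
Variables (S : zmodClosed V) (T : zmodClosed W).
Hypothesis fST : forall x, x \in S -> f x \in T.

Lemma quot_map_subproof x : x \in S -> (qproj T \o f) x = 0.
Proof. by move=> xS; apply/qproj_eq0/fST. Qed.

Definition quot_map : {additive quotient S -> quotient T} :=
  quot_lift quot_map_subproof.

Lemma quot_mapE x : quot_map (qproj S x) = qproj T (f x).
Proof. exact: quot_liftE. Qed.

End QuotMap.

Arguments quot_map : simpl never.

Section Span.
Variables (V : zmodType) (A : V -> Prop).

(* the intersection of all subgroups containing A *)
Definition zspan : {pred V} := fun x =>
  `[< forall S : zmodClosed V, (forall y, A y -> y \in S) -> x \in S >].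

Lemma zspan_zmod_closed : zmod_closed zspan.
Proof.
split=> [|x y /asboolP xA /asboolP yA]; apply/asboolP=> S AS; first exact: rpred0.
by rewrite rpredB ?xA ?yA.
Qed.
HB.instance Definition _ := GRing.isZmodClosed.Build V zspan zspan_zmod_closed.

Lemma mem_zspan x : A x -> x \in zspan.
Proof. by move=> Ax; apply/asboolP=> S; apply. Qed.

Lemma zspan_sub (S : zmodClosed V) :
  (forall y, A y -> y \in S) -> forall x, x \in zspan -> x \in S.
Proof. by move=> AS x /asboolP; apply. Qed.

End Span.

Lemma zspan_map (V W : zmodType) (f : {additive V -> W}) (A : V -> Prop)
    (T : zmodClosed W) :
  (forall y, A y -> f y \in T) -> forall x, x \in zspan A -> f x \in T.
Proof. by move=> AT x; apply: (@zspan_sub _ _ (preim_pred f T)). Qed.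

Lemma zspan_ker (V W : zmodType) (f : {additive V -> W}) (A : V -> Prop) :
  (forall y, A y -> f y = 0) -> forall x, x \in zspan A -> f x = 0.
Proof.
move=> A0 x /asboolP xA; apply/eqP.
have cl : zmod_closed (fun y => f y == 0 : bool).
  split=> [|y z]; rewrite /in_mem /= ?raddf0 // => /eqP fy /eqP fz.
  by rewrite raddfB fy fz subrr.
pose Kz := GRing.isZmodClosed.Build V _ cl.
pose K : zmodClosed V := HB.pack (fun y => f y == 0 : bool) Kz.
by apply: (xA K) => y /A0 /eqP.
Qed.

Section FreeLift.
Variables (K : choiceType) (M : zmodType) (f : K -> M).

(* the additive extension of f; zmodule M is M as a module over int *)
Definition free_lift (D : {freeg K}) : M := @fglift int (zmodule M) K f D.

Lemma free_lift_is_additive : zmod_morphism free_lift.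
Proof. exact: (@lift_is_additive int K (zmodule M) f). Qed.
HB.instance Definition _ :=
  GRing.isZmodMorphism.Build {freeg K} M free_lift free_lift_is_additive.

Lemma free_liftU k : free_lift << k >> = f k.
Proof. by rewrite /free_lift liftU scale1r. Qed.

End FreeLift.

Lemma free_ext (K : choiceType) (M : zmodType) (f g : {additive {freeg K} -> M}) :
  (forall k, f << k >> = g << k >>) -> f =1 g.
Proof.
move=> fg D; rewrite -(freeg_sumE D) !raddf_sum; apply: eq_bigr => k _.
have -> : << coeff k D *g k >> = << k >> *~ coeff k D :> {freeg K}.
  by rewrite freeg_mulz intz.
by rewrite !raddfMz fg.
Qed.

(* Nonnegatively graded; the groups in negative degrees are 0. *)
Record complex := Complex {
  chain :> nat -> zmodType;
  bd : forall n, {additive chain n.+1 -> chain n};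
  bd_bd : forall n x, bd n (bd n.+1 x) = 0 }.

Record chain_map (C D : complex) := ChainMap {
  cmap :> forall n, {additive C n -> D n};
  cmap_bd : forall n x, cmap n (bd C n x) = bd D n (cmap n.+1 x) }.

#[local] Obligation Tactic := idtac.

Program Definition cmap_id (C : complex) : chain_map C C :=
  @ChainMap C C (fun n => idfun) _.
Next Obligation. by []. Qed.

Program Definition cmap_comp (C D E : complex)
    (g : chain_map D E) (f : chain_map C D) : chain_map C E :=
  @ChainMap C E (fun n => g n \o f n) _.
Next Obligation. by move=> C D E g f n x /=; rewrite !cmap_bd. Qed.

Section Homology.
Variables (C : complex) (n : nat).

Definition cycles : {pred C n} :=
  match n return pred (C n) with
  | 0 => xpredT
  | m.+1 => fun x => bd C m x == 0
  end.

Lemma cycles_zmod_closed : zmod_closed cycles.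
Proof.
rewrite /cycles; case: n => [|m] //; split=> [|x y].
  by rewrite unfold_in /= raddf0.
by rewrite !unfold_in /= raddfB => /eqP-> /eqP->; rewrite subrr.
Qed.
HB.instance Definition _ := GRing.isZmodClosed.Build (C n) cycles cycles_zmod_closed.

Definition boundaries : {pred subgroup cycles} := fun z =>
  `[< exists y, bd C n y = sgval z >].

Lemma boundaries_zmod_closed : zmod_closed boundaries.
Proof.
split=> [|x y /asboolP[x' xE] /asboolP[y' yE]]; apply/asboolP.
  by exists 0; rewrite !raddf0.
by exists (x' - y'); rewrite !raddfB xE yE.
Qed.
HB.instance Definition _ :=
  GRing.isZmodClosed.Build (subgroup cycles) boundaries boundaries_zmod_closed.

Definition homology : zmodType := quotient boundaries.

Definition hclass : {additive subgroup cycles -> homology} := qproj boundaries.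

Lemma hclass_surj h : exists z, hclass z = h.
Proof. exact: qproj_surj. Qed.

Lemma hclass_eq0 z : hclass z = 0 <-> exists y, bd C n y = sgval z.
Proof.
split=> [/qproj_eq0/asboolP //|zb].
by apply/qproj_eq0/asboolP.
Qed.

End Homology.

Arguments hclass : simpl never.

Arguments cycles : clear implicits.
Arguments boundaries : clear implicits.
Arguments hclass : clear implicits.

Lemma cyclesS (C : complex) n (x : C n.+1) : (x \in cycles C n.+1) = (bd C n x == 0).
Proof. by []. Qed.

Lemma bd_cycle (C : complex) n (x : C n.+1) : bd C n x \in cycles C n.
Proof. by case: n x => [|n] x //; rewrite cyclesS bd_bd. Qed.

Section HomologyMap.
Variables (C D : complex) (f : chain_map C D) (n : nat).

Lemma cmap_cycle x : x \in cycles C n -> f n x \in cycles D n.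
Proof.
case: n x => [|m] x //; rewrite !cyclesS -cmap_bd => /eqP->.
by rewrite raddf0.
Qed.

Lemma cmap_boundary z : z \in boundaries C n ->
  subgroup_map cmap_cycle z \in boundaries D n.
Proof.
by move=> /asboolP[y yz]; apply/asboolP; exists (f n.+1 y); rewrite -cmap_bd yz.
Qed.

Definition hmap : {additive homology C n -> homology D n} :=
  quot_map cmap_boundary.

Lemma hmapE z : hmap (hclass C n z) = hclass D n (subgroup_map cmap_cycle z).
Proof. exact: quot_mapE. Qed.

End HomologyMap.

Arguments hmap : simpl never.

Lemma eq_hmap (C D : complex) (f g : chain_map C D) n :
  f n =1 g n -> hmap f n =1 hmap g n.
Proof.
move=> fg h; have [z <-] := hclass_surj h; rewrite !hmapE.
by congr (hclass _ _ _); apply: val_inj; rewrite /= fg.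
Qed.

Lemma hmap_id (C : complex) (f : chain_map C C) n :
  f n =1 id -> hmap f n =1 id.
Proof.
move=> fE h; have [z <-] := hclass_surj h; rewrite !hmapE.
by congr (hclass _ _ _); apply: val_inj; rewrite /= fE.
Qed.

Lemma hmap_comp (C D E : complex) (f : chain_map C D) (g : chain_map D E)
    (k : chain_map C E) n :
  (forall x, k n x = g n (f n x)) -> forall h, hmap k n h = hmap g n (hmap f n h).
Proof.
move=> kE h; have [z <-] := hclass_surj h; rewrite !hmapE.
by congr (hclass _ _ _); apply: val_inj; rewrite /= kE.
Qed.

Record subcomplex (C : complex) := SubComplex {
  part :> forall n, zmodClosed (C n);
  part_bd : forall n x, x \in part n.+1 -> bd C n x \in part n }.

Program Definition sub_complex (C : complex) (S : subcomplex C) : complex :=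
  @Complex (fun n => subgroup (S n)) (fun n => subgroup_map (@part_bd C S n)) _.
Next Obligation. by move=> C S n x; apply: val_inj; rewrite /= bd_bd. Qed.

Program Definition sub_cmap (C D : complex) (f : chain_map C D)
    (S : subcomplex C) (T : subcomplex D)
    (fST : forall n x, x \in S n -> f n x \in T n) :
    chain_map (sub_complex S) (sub_complex T) :=
  @ChainMap (sub_complex S) (sub_complex T) (fun n => subgroup_map (@fST n)) _.
Next Obligation. by move=> C D f S T fST n x; apply: val_inj; rewrite /= cmap_bd. Qed.

Definition sub_incl (C : complex) (S T : subcomplex C)
    (ST : forall n x, x \in S n -> x \in T n) :
    chain_map (sub_complex S) (sub_complex T) :=
  @sub_cmap C C (cmap_id C) S T ST.

Program Definition quot_complex (C : complex) (S : subcomplex C) : complex :=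
  @Complex (fun n => quotient (S n)) (fun n => quot_map (@part_bd C S n)) _.
Next Obligation.
by move=> C S n x; have [y <-] := qproj_surj x; rewrite !quot_mapE bd_bd raddf0.
Qed.

Program Definition quot_proj (C : complex) (S : subcomplex C) :
    chain_map C (quot_complex S) :=
  @ChainMap C (quot_complex S) (fun n => qproj (S n)) _.
Next Obligation. by move=> C S n x; rewrite quot_mapE. Qed.

Program Definition quot_cmap (C D : complex) (f : chain_map C D)
    (S : subcomplex C) (T : subcomplex D)
    (fST : forall n x, x \in S n -> f n x \in T n) :
    chain_map (quot_complex S) (quot_complex T) :=
  @ChainMap (quot_complex S) (quot_complex T) (fun n => quot_map (@fST n)) _.
Next Obligation.
by move=> C D f S T fST n x; have [y <-] := qproj_surj x; rewrite !quot_mapE cmap_bd.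
Qed.

(* S viewed as a subcomplex of the complex T; used for S contained in T *)
Program Definition relative (C : complex) (S T : subcomplex C) :
    subcomplex (sub_complex T) :=
  @SubComplex (sub_complex T) (fun n => preim_pred (@sgval (C n) (T n)) (S n)) _.
Next Obligation. by move=> C S T n x; apply: part_bd. Qed.

Definition exact_at (A B C : zmodType) (f : A -> B) (g : B -> C) : Prop :=
  forall y, g y = 0 <-> exists x, f x = y.

Record short_exact := ShortExact {
  ses_sub : complex;
  ses_tot : complex;
  ses_quot : complex;
  ses_incl : chain_map ses_sub ses_tot;
  ses_proj : chain_map ses_tot ses_quot;
  ses_inj : forall n, injective (ses_incl n);
  ses_exact : forall n, exact_at (ses_incl n) (ses_proj n);
  ses_surj : forall n y, exists x, ses_proj n x = y }.

Section Connecting.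
Variables (S : short_exact) (n : nat).
Local Notation A := (ses_sub S).
Local Notation B := (ses_tot S).
Local Notation C := (ses_quot S).
Local Notation i := (ses_incl S).
Local Notation p := (ses_proj S).

(* w = [a] and z = [c] for some c = p b and i a = bd b *)
Definition snake (z : homology C n.+1) (w : homology A n) : Prop :=
  exists (c : subgroup (cycles C n.+1)) (b : B n.+1) (a : subgroup (cycles A n)),
    [/\ hclass C n.+1 c = z, p n.+1 b = sgval c,
        i n (sgval a) = bd B n b & hclass A n a = w].

Lemma ses_comp m x : p m (i m x) = 0.
Proof. by apply/(ses_exact (s := S)); exists x. Qed.

Lemma ses_cycle m (a : A m) (b : B m.+1) : i m a = bd B m b -> a \in cycles A m.
Proof.
case: m a b => [|m] a b // ia; rewrite cyclesS; apply/eqP.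
by apply: (@ses_inj S m); rewrite cmap_bd ia bd_bd raddf0.
Qed.

Lemma snakeB z z' w w' : snake z w -> snake z' w' -> snake (z - z') (w - w').
Proof.
move=> [c [b [a [<- pb ia <-]]]] [c' [b' [a' [<- pb' ia' <-]]]].
exists (c - c'), (b - b'), (a - a').
by split; rewrite ?[in LHS]raddfB ?raddfB ?pb ?pb' ?ia ?ia'.
Qed.

Lemma snake0 w : snake 0 w -> w = 0.
Proof.
move=> [c [b [a [/hclass_eq0[e ec] pb ia <-]]]].
have [e' pe'] := ses_surj e.
have : p n.+1 (b - bd B n.+1 e') = 0.
  by rewrite raddfB cmap_bd pe' ec pb subrr.
move=> /ses_exact[a' ia']; apply/hclass_eq0; exists a'.
apply: (@ses_inj S n); rewrite cmap_bd ia' raddfB bd_bd subr0.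
by rewrite ia.
Qed.

Lemma snake_total z : exists w, snake z w.
Proof.
have [c cz] := hclass_surj z; have [b pb] := ses_surj (sgval c).
have /ses_exact[a ia] : p n (bd B n b) = 0.
  by rewrite cmap_bd pb; apply/eqP; rewrite -cyclesS sgvalP.
have acyc := ses_cycle ia.
by exists (hclass A n (Subgroup acyc)), c, b, (Subgroup acyc).
Qed.

Definition connecting_fun (z : homology C n.+1) : homology A n :=
  xget 0 [set w | snake z w].

Lemma connecting_snake z : snake z (connecting_fun z).
Proof. by have [w zw] := snake_total z; apply: (xgetI _ zw). Qed.

Lemma snake_fun z w : snake z w -> w = connecting_fun z.
Proof.
move=> zw; apply/eqP; rewrite -subr_eq0; apply/eqP/snake0.
by rewrite -(subrr z); apply: snakeB zw (connecting_snake z).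
Qed.

Lemma connecting_is_additive : zmod_morphism connecting_fun.
Proof.
by move=> x y; apply/esym/snake_fun/snakeB; apply: connecting_snake.
Qed.
HB.instance Definition _ := GRing.isZmodMorphism.Build
  (homology C n.+1) (homology A n) connecting_fun connecting_is_additive.

Definition connecting : {additive homology C n.+1 -> homology A n} :=
  connecting_fun.

End Connecting.

Record diagram (d : Order.disp_t) (T : porderType d) := Diagram {
  ob :> T -> zmodType;
  tr : forall s t, (s <= t)%O -> {additive ob s -> ob t};
  tr_id : forall s (ss : (s <= s)%O) x, tr ss x = x;
  tr_comp : forall s t u (st : (s <= t)%O) (tu : (t <= u)%O) (su : (s <= u)%O) x,
    tr tu (tr st x) = tr su x }.

Record diagram_map d (T : porderType d) (M N : diagram T) := DiagramMap {
  dmap :> forall t, {additive M t -> N t};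
  dmap_tr : forall s t (st : (s <= t)%O) x,
    dmap t (tr M st x) = tr N st (dmap s x) }.

Section Colimit.
Variables (d : Order.disp_t) (T : porderType d) (M : diagram T).

(* The colimit by generators (t, x), x : M t, and relations; for T empty it
   is 0. Its universal property is colim_in_tr, colim_descE and colim_ext. *)
Definition colim_gen : choiceType := {t : T & M t}.
Definition gen (t : T) (x : M t) : {freeg colim_gen} :=
  << (existT (fun t => GRing.Zmodule.sort (M t)) t x : colim_gen) >>.

Inductive colim_rel : {freeg colim_gen} -> Prop :=
| colim_rel_add t (x y : M t) : colim_rel (gen (x - y) - (gen x - gen y))
| colim_rel_tr s t (st : (s <= t)%O) (x : M s) :
    colim_rel (gen (tr M st x) - gen x).

Definition colim : zmodType := quotient (zspan colim_rel).

Definition colim_in_fun (t : T) (x : M t) : colim := qproj (zspan colim_rel) (gen x).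

Lemma colim_in_is_additive t : zmod_morphism (@colim_in_fun t).
Proof.
move=> x y; rewrite /colim_in_fun -raddfB; apply/qproj_eq.
exact/mem_zspan/colim_rel_add.
Qed.
HB.instance Definition _ t := GRing.isZmodMorphism.Build
  (M t) colim (@colim_in_fun t) (@colim_in_is_additive t).

Definition colim_in t : {additive M t -> colim} := @colim_in_fun t.

Lemma colim_in_tr s t (st : (s <= t)%O) x : colim_in t (tr M st x) = colim_in s x.
Proof.
apply/qproj_eq; exact/mem_zspan/colim_rel_tr.
Qed.

Section Desc.
Variables (L : zmodType) (g : forall t, {additive M t -> L}).
Hypothesis g_tr : forall s t (st : (s <= t)%O) x, g t (tr M st x) = g s x.

Definition desc_gen (k : colim_gen) : L := g (tag k) (tagged k).

Lemma desc_rel D : D \in zspan colim_rel -> free_lift desc_gen D = 0.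
Proof.
apply: zspan_ker => _ [t x y|s t st x]; rewrite !raddfB /= !free_liftU /desc_gen /=.
  by rewrite raddfB -opprD subrr.
by rewrite g_tr subrr.
Qed.

Definition colim_desc : {additive colim -> L} := quot_lift desc_rel.

Lemma colim_descE t x : colim_desc (colim_in t x) = g t x.
Proof.
exact: etrans (quot_liftE desc_rel (gen x)) (free_liftU desc_gen _).
Qed.

End Desc.

Lemma colim_ext (L : zmodType) (u v : {additive colim -> L}) :
  (forall t x, u (colim_in t x) = v (colim_in t x)) -> u =1 v.
Proof.
move=> uv z; have [y <-] := qproj_surj z.
apply: (@free_ext _ _ (u \o qproj (zspan colim_rel))
                      (v \o qproj (zspan colim_rel))) => -[t x].
exact: uv.
Qed.

End Colimit.

Section ColimitMap.
Variables (d : Order.disp_t) (T : porderType d) (M N : diagram T).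
Variable f : diagram_map M N.

Lemma colim_map_tr s t (st : (s <= t)%O) x :
  (colim_in N t \o f t) (tr M st x) = (colim_in N s \o f s) x.
Proof. by rewrite /= dmap_tr; apply: colim_in_tr. Qed.

Definition colim_map : {additive colim M -> colim N} := colim_desc colim_map_tr.

End ColimitMap.

Section Below.
Variables (d : Order.disp_t) (T : porderType d) (l : T).

Record below := Below { bval : T; bvalP : (bval < l)%O }.

HB.instance Definition _ := [isSub for bval].
HB.instance Definition _ := [Choice of below by <:].
HB.instance Definition _ := [SubChoice_isSubPOrder of below by <: with d].

End Below.

Section LeftLimit.
Variables (d : Order.disp_t) (T : porderType d).

Program Definition restrict_below (M : diagram T) (l : T) : diagram (below l) :=
  @Diagram d (below l) (fun t => M (bval t)) (fun s t st => tr M st) _ _.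
Next Obligation. by move=> M l s ss x; apply: tr_id. Qed.
Next Obligation. by move=> M l s t u st tu su x; apply: tr_comp. Qed.

Definition left_lim (M : diagram T) (l : T) : zmodType := colim (restrict_below M l).

Program Definition restrict_map (M N : diagram T) (f : diagram_map M N) (l : T) :
    diagram_map (restrict_below M l) (restrict_below N l) :=
  @DiagramMap d (below l) (restrict_below M l) (restrict_below N l)
    (fun t => f (bval t)) _.
Next Obligation.
by move=> M N f l s t st x; apply: (dmap_tr f (st : (bval s <= bval t)%O)).
Qed.

Definition left_lim_map (M N : diagram T) (f : diagram_map M N) (l : T) :
    {additive left_lim M l -> left_lim N l} := colim_map (restrict_map f l).

Section Transition.
Variables (M : diagram T) (l : T).

Definition from_below (t : below l) : {additive M (bval t) -> M l} :=
  tr M (ltW (bvalP t)).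

Lemma from_below_tr s t (st : (s <= t)%O) x :
  from_below t (tr (restrict_below M l) st x) = from_below s x.
Proof. exact: tr_comp. Qed.

Definition left_lim_tr : {additive left_lim M l -> M l} :=
  @colim_desc _ _ (restrict_below M l) (M l) from_below from_below_tr.

End Transition.

End LeftLimit.

(* Classically every type carries a choiceType structure, so the carrier is an
   arbitrary set. *)
Record ext_metric (R : realType) := ExtMetric {
  point :> choiceType;
  dist : point -> point -> \bar R;
  dist_ge0 : forall x y, (0 <= dist x y)%E;
  dist_xx : forall x, dist x x = 0%E;
  dist_sym : forall x y, dist x y = dist y x;
  dist_triangle : forall x y z, (dist x z <= dist x y + dist y z)%E;
  dist_eq0 : forall x y, dist x y = 0%E -> x = y }.

Record nonexpansive (R : realType) (X Y : ext_metric R) := Nonexpansive {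
  nexp_fun :> X -> Y;
  nexp_dist : forall x x', (dist (nexp_fun x) (nexp_fun x') <= dist x x')%E }.

Lemma alternating_sum0 (V : zmodType) m (G : 'I_m.+1 -> 'I_m -> V) :
  (forall j k : 'I_m, (j <= k)%N ->
    G (lift ord0 k) j = - G (widen_ord (leqnSn m) j) k) ->
  \sum_(i < m.+1) \sum_(j < m) G i j = 0.
Proof.
move=> GE.
under eq_bigr => i _ do rewrite (bigID (fun j : 'I_m => (j < i)%N)) /=.
rewrite big_split /= big_ord_recl /= big_pred0 ?add0r //.
rewrite [X in _ + X]big_ord_recr /= [X in _ + (_ + X)]big_pred0 ?addr0; last first.
  by move=> j; rewrite ltn_ord.
rewrite [X in _ + X](exchange_big_dep xpredT) //= -big_split /=.
apply: big1 => k _; apply/eqP; rewrite addr_eq0 -sumrN.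
rewrite [X in X == _](eq_bigl (fun j : 'I_m => ~~ (k < j)%N)); last first.
  by move=> j; rewrite /= -leqNgt.
by apply/eqP; apply: eq_bigr => j; rewrite -leqNgt => /GE.
Qed.

Section Nerve.
Variables (R : realType) (X : ext_metric R).

Definition nerve (n : nat) : choiceType := {ffun 'I_n.+1 -> X}.

Definition face n (i : 'I_n.+2) (x : nerve n.+1) : nerve n :=
  [ffun j => x (lift i j)].

(* unbump i j is j for j <= i and j - 1 for j > i *)
Definition degen n (i : 'I_n.+1) (x : nerve n) : nerve n.+1 :=
  [ffun j : 'I_n.+2 => x (inord (unbump i j))].

Inductive degenerate : forall n, nerve n -> Prop :=
| Degenerate n (i : 'I_n.+1) (y : nerve n) : degenerate (degen i y).

Definition len n (x : nerve n) : \bar R :=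
  (\sum_(i < n) dist (x (inord i)) (x (inord i.+1)))%E.

Lemma faceE n (i : 'I_n.+2) (x : nerve n.+1) (k : nat) :
  (k < n.+1)%N -> face i x (inord k) = x (inord (bump i k)).
Proof.
by move=> kn; rewrite ffunE; congr (x _); apply: val_inj;
  rewrite /= !inordK //; rewrite /bump; case: (i <= k)%N => //=; rewrite add0n ltnW.
Qed.

Lemma degenerateP n (x : nerve n) :
  degenerate x <-> exists2 k : nat, (k < n)%N & x (inord k) = x (inord k.+1).
Proof.
split=> [[{x}n i y]|[k]].
  exists (i : nat) => //; rewrite !ffunE; congr (y (inord _)).
  have i2 : (i < n.+2)%N by rewrite ltnW // ltnS.
  have i3 : (i.+1 < n.+2)%N by rewrite ltnS.
  by rewrite !inordK // /unbump ltnn ltnSn subn0 subn1.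
case: n x => [//|m] x km xk.
have -> : x = degen (inord k : 'I_m.+1) (face (inord k) x); last exact: Degenerate.
apply/ffunP=> j; rewrite ffunE.
have jm := ltn_ord j.
have ub : (unbump (inord k : 'I_m.+1) j < m.+1)%N.
  by rewrite inordK // /unbump; case: (ltnP k j) => kj /=; lia.
rewrite faceE // !inordK //; last by lia.
have [kj|jk|kj] := ltngtP k (j : nat).
- rewrite /unbump kj subn1 /bump.
  have -> : (k <= j.-1)%N by lia.
  by rewrite add1n prednK ?inord_val //; lia.
- rewrite /unbump /bump ltnNge (ltnW jk) /= subn0 leqNgt jk add0n inord_val //.
- by rewrite -kj /unbump ltnn subn0 /bump leqnn add1n -xk kj inord_val.
Qed.

Lemma len_face n (i : 'I_n.+2) (x : nerve n.+1) : (len (face i x) <= len x)%E.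
Proof.
pose D a b := dist (x (inord a)) (x (inord b)).
have -> : len (face i x) = (\sum_(k < n) D (bump i k) (bump i k.+1))%E.
  apply: eq_bigr => k _; have kn := ltn_ord k.
  by rewrite !faceE // ltnW.
suff H m j : (j <= m.+1)%N ->
    (\sum_(k < m) D (bump j k) (bump j k.+1) <= \sum_(k < m.+1) D k k.+1)%E.
  by apply: H; rewrite -ltnS.
have D0 a b : (0 <= D a b)%E by apply: dist_ge0.
have sum0 p : (0 <= \sum_(k < p) D k k.+1)%E by apply: sume_ge0.
elim: m => [|m IH] jm; first by rewrite big_ord0.
rewrite big_ord_recr [leRHS]big_ord_recr /=.
have [jm1|jm1] := leqP j m.
  have -> : D (bump j m) (bump j m.+1) = D m.+1 m.+2.
    by rewrite /bump jm1 (leqW jm1) !add1n.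
  by apply: leeD => //; apply: IH; apply: leqW.
have pre p : (p < j)%N ->
    (\sum_(k < p) D (bump j k) (bump j k.+1) = \sum_(k < p) D k k.+1)%E.
  move=> pj; apply: eq_bigr => k _; have kp := ltn_ord k.
  by congr (D _ _); rewrite /bump; lia.
rewrite pre // big_ord_recr /= -addeA leeD2l //.
rewrite /bump [(j <= m)%N]leqNgt jm1 add0n.
have [jm2|jm2] := leqP j m.+1; last by rewrite leeDl.
exact: dist_triangle.
Qed.

Lemma face_face n (j k : 'I_n.+2) (x : nerve n.+2) : (j <= k)%N ->
  face j (face (lift ord0 k) x) = face k (face (widen_ord (leqnSn _) j) x).
Proof.
move=> jk; apply/ffunP=> a; rewrite !ffunE; congr (x _); apply: val_inj => /=.
by rewrite /bump /=; lia.
Qed.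

Definition nerve_bd n : {additive {freeg (nerve n.+1)} -> {freeg (nerve n)}} :=
  free_lift (fun x : nerve n.+1 =>
    \sum_(i < n.+2) << face i x >> *~ (-1) ^+ i : {freeg (nerve n)}).

Lemma nerve_bdU n (x : nerve n.+1) :
  nerve_bd n << x >> = \sum_(i < n.+2) << face i x >> *~ (-1) ^+ i.
Proof. exact: free_liftU. Qed.

Lemma nerve_bd_bd n c : nerve_bd n (nerve_bd n.+1 c) = 0.
Proof.
apply: (@free_ext _ _ (nerve_bd n \o nerve_bd n.+1) (\0 : {additive _ -> _})).
move=> x /=; rewrite nerve_bdU raddf_sum.
under eq_bigr => i _ do rewrite raddfMz nerve_bdU mulrz_suml.
apply: alternating_sum0 => j k jk; rewrite face_face //= -!mulrzA -mulrNz.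
by rewrite exprS mulN1r mulrN mulrC.
Qed.

Definition nerve_complex : complex := Complex nerve_bd_bd.

Definition degenerate_chains n : zmodClosed {freeg (nerve n)} :=
  zspan (fun c => exists2 x : nerve n, degenerate x & c = << x >>).

Lemma degenerate_face n (x : nerve n.+1) (k : nat) (i : 'I_n.+2) :
  (k < n.+1)%N -> x (inord k) = x (inord k.+1) -> (i : nat) != k ->
  (i : nat) != k.+1 -> degenerate (face i x).
Proof.
move=> kn xk ik ik1; apply/degenerateP; have iN := ltn_ord i.
have [ltik|ltki|ki] := ltngtP i k; last by rewrite ki eqxx in ik.
  exists k.-1; first by lia.
  rewrite !faceE; [|lia|lia].
  have -> : bump i k.-1 = k by rewrite /bump; lia.
  by have -> : bump i k.-1.+1 = k.+1 by rewrite /bump; lia.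
exists k; first by lia.
rewrite !faceE; [|lia|lia].
have -> : bump i k = k by rewrite /bump; lia.
by have -> : bump i k.+1 = k.+1 by rewrite /bump; lia.
Qed.

Lemma face_repeat n (x : nerve n.+1) (k : nat) :
  (k < n.+1)%N -> x (inord k) = x (inord k.+1) ->
  face (inord k) x = face (inord k.+1) x.
Proof.
move=> kn xk; apply/ffunP => a; rewrite -[a]inord_val !faceE // !inordK //; last first.
  by rewrite ltnW // ltnS.
have [ak|ka|->] := ltngtP a k.
- by have -> : bump k a = bump k.+1 a by rewrite /bump; lia.
- by have -> : bump k a = bump k.+1 a by rewrite /bump; lia.
- have -> : bump k k = k.+1 by rewrite /bump; lia.
  by have -> : bump k.+1 k = k by rewrite /bump; lia.
Qed.

Lemma degenerate_chains_bd n c :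
  c \in degenerate_chains n.+1 -> nerve_bd n c \in degenerate_chains n.
Proof.
apply: zspan_map => _ [x /degenerateP[k kn xk] ->]; rewrite nerve_bdU.
have vk : (inord k : 'I_n.+2) = k :> nat by rewrite inordK // ltnW.
have vk1 : (inord k.+1 : 'I_n.+2) = k.+1 :> nat by rewrite inordK.
rewrite (bigD1 (inord k)) //= (bigD1 (inord k.+1)) /=; last first.
  by rewrite -val_eqE /= vk vk1; lia.
rewrite addrA vk vk1 (face_repeat kn xk) exprS mulN1r mulrNz subrr add0r.
apply: rpred_sum => i /andP[]; rewrite -!val_eqE /= vk vk1 => ik ik1.
apply: rpredMz; apply: mem_zspan; exists (face i x) => //.
exact: degenerate_face ik ik1.
Qed.

Definition degenerate_subcomplex : subcomplex nerve_complex :=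
  @SubComplex nerve_complex degenerate_chains degenerate_chains_bd.

Definition normalised : complex := quot_complex degenerate_subcomplex.

Definition tup n (x : nerve n) : normalised n :=
  qproj (degenerate_chains n) << x >>.

Lemma tup_degenerate n (x : nerve n) : degenerate x -> tup x = 0.
Proof. by move=> dx; apply/qproj_eq0/mem_zspan; exists x. Qed.

Lemma bd_tup n (x : nerve n.+1) :
  bd normalised n (tup x) = \sum_(i < n.+2) tup (face i x) *~ (-1) ^+ i.
Proof.
rewrite /tup quot_mapE nerve_bdU raddf_sum.
by apply: eq_bigr => i _; rewrite raddfMz.
Qed.

Definition filt_chains (l : {nonneg R}) n : zmodClosed (normalised n) :=
  zspan (fun c => exists x : nerve n,
    [/\ ~ degenerate x, (len x <= l%:num%:E)%E & c = tup x]).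

Lemma tup_filt l n (x : nerve n) : (len x <= l%:num%:E)%E -> tup x \in filt_chains l n.
Proof.
move=> xl; have [dx|ndx] := pselect (degenerate x).
  by rewrite tup_degenerate // rpred0.
by apply: mem_zspan; exists x.
Qed.

Lemma filt_chains_bd l n c :
  c \in filt_chains l n.+1 -> bd normalised n c \in filt_chains l n.
Proof.
apply: zspan_map => _ [x [_ xl ->]]; rewrite bd_tup.
apply: rpred_sum => i _; apply/rpredMz/tup_filt.
exact: le_trans (len_face i x) xl.
Qed.

Definition filt (l : {nonneg R}) : subcomplex normalised :=
  SubComplex (@filt_chains_bd l).

Lemma filt_mono (s t : {nonneg R}) n c :
  s <= t -> c \in filt s n -> c \in filt t n.
Proof.
move=> st; apply: zspan_sub => _ [x [_ xs ->]]; apply: tup_filt.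
by rewrite (le_trans xs) // lee_fin.
Qed.

(* The first disjunct only matters for l = 0, where the union is empty. *)
Definition filt_lt_chains (l : {nonneg R}) n : {pred normalised n} := fun c =>
  `[< c = 0 \/ exists2 t : {nonneg R}, t < l & c \in filt t n >].

Arguments filt_lt_chains : clear implicits.

Lemma filt_lt_chainsP l n c :
  c \in filt_lt_chains l n <-> c = 0 \/ exists2 t : {nonneg R}, t < l & c \in filt t n.
Proof. by split=> [/asboolP|cl] //; apply/asboolP. Qed.

Lemma filt_lt_zmod_closed l n : zmod_closed (filt_lt_chains l n).
Proof.
split=> [|x y]; first by apply/filt_lt_chainsP; left.
move=> /filt_lt_chainsP[->|[s sl xs]] /filt_lt_chainsP[->|[t tl yt]];
  apply/filt_lt_chainsP.
- by left; rewrite subrr.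
- by right; exists t; rewrite // sub0r rpredN.
- by right; exists s; rewrite // subr0.
- right; have [st|ts] := leP s t; [exists t|exists s] => //; apply: rpredB => //.
    exact: filt_mono xs.
  exact: filt_mono (ltW ts) yt.
Qed.
HB.instance Definition _ l n := GRing.isZmodClosed.Build (normalised n)
  (filt_lt_chains l n) (filt_lt_zmod_closed l n).

Lemma filt_lt_chains_bd l n c :
  c \in filt_lt_chains l n.+1 -> bd normalised n c \in filt_lt_chains l n.
Proof.
move=> /filt_lt_chainsP[->|[t tl ct]]; apply/filt_lt_chainsP.
  by left; rewrite raddf0.
by right; exists t => //; apply: part_bd.
Qed.

Definition filt_lt (l : {nonneg R}) : subcomplex normalised :=
  @SubComplex normalised (fun n => filt_lt_chains l n) (@filt_lt_chains_bd l).

Lemma filt_lt_filt l n c : c \in filt_lt l n -> c \in filt l n.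
Proof.
move=> /filt_lt_chainsP[->|[t tl ct]]; first exact: rpred0.
exact: filt_mono (ltW tl) ct.
Qed.

Lemma filt_sub_lt (t l : {nonneg R}) n c : t < l -> c \in filt t n -> c \in filt_lt l n.
Proof. by move=> tl ct; apply/filt_lt_chainsP; right; exists t. Qed.

Definition FC (l : {nonneg R}) : complex := sub_complex (filt l).
Definition FltC (l : {nonneg R}) : complex := sub_complex (filt_lt l).

Definition magnitude_subcomplex l : subcomplex (FC l) := relative (filt_lt l) (filt l).
Definition magnitude_complex l : complex := quot_complex (magnitude_subcomplex l).

Program Definition magnitude_ses (l : {nonneg R}) : short_exact :=
  @ShortExact (FltC l) (FC l) (magnitude_complex l)
    (sub_incl (@filt_lt_filt l)) (quot_proj (magnitude_subcomplex l)) _ _ _.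
Next Obligation. by move=> l n x y /(congr1 val) /= xy; apply: val_inj. Qed.
Next Obligation.
move=> l n y; split=> [/qproj_eq0 yl|[x <-]].
  by exists (Subgroup (yl : sgval y \in filt_lt l n)); apply: val_inj.
by apply/qproj_eq0; apply: (sgvalP x).
Qed.
Next Obligation. by move=> l n y; apply: qproj_surj. Qed.

Program Definition PH n : diagram {nonneg R} :=
  @Diagram _ {nonneg R} (fun l => homology (FC l) n)
    (fun s t st => hmap (sub_incl (fun m x => @filt_mono s t m x st)) n) _ _.
Next Obligation. by move=> n s ss; apply: hmap_id => x; apply: val_inj. Qed.
Next Obligation.
by move=> n s t u st tu su x; apply/esym/hmap_comp => {}x; apply: val_inj.
Qed.

Definition MH n (l : {nonneg R}) : zmodType := homology (magnitude_complex l) n.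

Definition tau n l : {additive left_lim (PH n) l -> PH n l} := left_lim_tr (PH n) l.

Definition rho n l : {additive PH n l -> MH n l} :=
  hmap (quot_proj (magnitude_subcomplex l)) n.

Section Kappa.
Variables (n : nat) (l : {nonneg R}).

Definition kappa_stage (t : below l) :
    {additive PH n (bval t) -> homology (FltC l) n} :=
  hmap (sub_incl (fun m x => @filt_sub_lt _ l m x (bvalP t))) n.

Lemma kappa_tr s t (st : (s <= t)%O) x :
  kappa_stage t (tr (restrict_below (PH n) l) st x) = kappa_stage s x.
Proof. by apply/esym/hmap_comp => {}x; apply: val_inj. Qed.

(* the canonical comparison of colim_{t < l} H_n(F_t) with H_n(F_{<l}) *)
Definition kappa : {additive left_lim (PH n) l -> homology (FltC l) n} :=
  @colim_desc _ _ (restrict_below (PH n) l) _ kappa_stage kappa_tr.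

End Kappa.

End Nerve.

Section Functoriality.
Variables (R : realType) (X Y : ext_metric R) (f : nonexpansive X Y).

Definition nerve_fun n (x : nerve X n) : nerve Y n := [ffun i => f (x i)].

Lemma nerve_fun_face n (i : 'I_n.+2) (x : nerve X n.+1) :
  nerve_fun (face i x) = face i (nerve_fun x).
Proof. by apply/ffunP=> j; rewrite !ffunE. Qed.

Lemma nerve_fun_degenerate n (x : nerve X n) : degenerate x -> degenerate (nerve_fun x).
Proof.
move=> /degenerateP[k kn xk]; apply/degenerateP; exists k => //.
by rewrite !ffunE xk.
Qed.

Lemma len_nerve_fun n (x : nerve X n) : (len (nerve_fun x) <= len x)%E.
Proof. by apply: lee_sum => i _; rewrite !ffunE; apply: nexp_dist. Qed.

Definition nerve_lin n : {additive {freeg (nerve X n)} -> {freeg (nerve Y n)}} :=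
  free_lift (fun x : nerve X n => << nerve_fun x >> : {freeg (nerve Y n)}).

Lemma nerve_linU n (x : nerve X n) : nerve_lin n << x >> = << nerve_fun x >>.
Proof. exact: free_liftU. Qed.

Lemma nerve_lin_bd n c : nerve_lin n (nerve_bd X n c) = nerve_bd Y n (nerve_lin n.+1 c).
Proof.
apply: (@free_ext _ _ (nerve_lin n \o nerve_bd X n) (nerve_bd Y n \o nerve_lin n.+1)).
move=> x /=; rewrite nerve_linU !nerve_bdU raddf_sum; apply: eq_bigr => i _.
by rewrite raddfMz nerve_linU nerve_fun_face.
Qed.

Definition nerve_cmap : chain_map (nerve_complex X) (nerve_complex Y) :=
  @ChainMap (nerve_complex X) (nerve_complex Y) nerve_lin nerve_lin_bd.

Lemma nerve_lin_degenerate n c :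
  c \in degenerate_chains X n -> nerve_lin n c \in degenerate_chains Y n.
Proof.
apply: zspan_map => _ [x dx ->]; rewrite nerve_linU; apply: mem_zspan.
by exists (nerve_fun x) => //; apply: nerve_fun_degenerate.
Qed.

Definition normalised_map : chain_map (normalised X) (normalised Y) :=
  @quot_cmap _ _ nerve_cmap (degenerate_subcomplex X) (degenerate_subcomplex Y)
    nerve_lin_degenerate.

Lemma normalised_map_tup n (x : nerve X n) :
  normalised_map n (tup x) = tup (nerve_fun x).
Proof. by rewrite /tup quot_mapE nerve_linU. Qed.

Lemma normalised_map_filt l n c :
  c \in filt X l n -> normalised_map n c \in filt Y l n.
Proof.
apply: zspan_map => _ [x [_ xl ->]]; rewrite normalised_map_tup.
exact/tup_filt/(le_trans (len_nerve_fun x)).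
Qed.

Lemma normalised_map_filt_lt l n c :
  c \in filt_lt X l n -> normalised_map n c \in filt_lt Y l n.
Proof.
move=> /filt_lt_chainsP[->|[t tl ct]]; apply/filt_lt_chainsP.
  by left; rewrite raddf0.
by right; exists t => //; apply: normalised_map_filt.
Qed.

Definition FC_map l : chain_map (FC X l) (FC Y l) := sub_cmap (@normalised_map_filt l).

Lemma FC_map_magnitude l n c :
  c \in magnitude_subcomplex X l n -> FC_map l n c \in magnitude_subcomplex Y l n.
Proof. exact: normalised_map_filt_lt. Qed.

Definition magnitude_map l : chain_map (magnitude_complex X l) (magnitude_complex Y l) :=
  quot_cmap (@FC_map_magnitude l).

Program Definition PH_map n : diagram_map (PH X n) (PH Y n) :=
  @DiagramMap _ _ (PH X n) (PH Y n) (fun l => hmap (FC_map l) n) _.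
Next Obligation.
move=> n s t st h.
pose k := cmap_comp (FC_map t) (sub_incl (fun m x => @filt_mono R X s t m x st)).
apply: etrans (esym (@hmap_comp _ _ _ _ _ k n (fun=> erefl) h)) _.
by apply: hmap_comp => x; apply: val_inj.
Qed.

Definition MH_map n l : {additive MH X n l -> MH Y n l} := hmap (magnitude_map l) n.

End Functoriality.

(* Main.v *)
(** An element of a directed colimit of abelian groups is [0] or comes from a
    stage, and a chain of [F_{<l}] lies in some [F_t] with [t < l]; so each cycle
    and each boundary of [F_{<l}] is already present at a stage below [l], and the
    comparison [kappa : colim_{t < l} H_n(F_t) -> H_n(F_{<l})] is bijective.
    Under [kappa], [tau] becomes the map induced by [F_{<l} -> F_l], so the
    sequence is the long exact homology sequence of
    [0 -> F_{<l} -> F_l -> MC_l -> 0], with [delta] the composite of the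
    connecting map and the inverse of [kappa]. *)

Require Import Defs.
From HB Require Import structures.
From mathcomp Require Import all_boot all_order all_algebra.
From mathcomp Require Import boolp.
From mathcomp Require Import reals interval_inference.

Set Implicit Arguments.
Unset Strict Implicit.
Unset Printing Implicit Defensive.

Import Order.TTheory GRing.Theory Num.Theory.

Local Open Scope ring_scope.

(** * The long exact homology sequence of a short exact sequence of complexes *)

Lemma hclass_eq (C : complex) n (x y : subgroup (cycles C n)) :
  hclass C n x = hclass C n y <-> exists b, bd C n b = sgval x - sgval y.
Proof. by split=> [/qproj_eq/asboolP|xy] //; apply/qproj_eq/asboolP. Qed.

Section LongExactSequence.
Variables (S : short_exact) (n : nat).
Local Notation i := (ses_incl S).
Local Notation p := (ses_proj S).

Lemma snake_connecting z : snake z (connecting S n z).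
Proof. exact: connecting_snake. Qed.

(** If [i a] bounds [b], then [p b] is a cycle and the zigzag through [b] shows that its class is
    sent to that of [a]. Conversely the middle term of a zigzag is a chain bounding [i a]. *)
Lemma exact_connecting_incl : exact_at (connecting S n) (hmap i n).
Proof.
move=> y; split=> [|[z <-]].
  have [a <-] := hclass_surj y; rewrite hmapE => /hclass_eq0[b /= bE].
  have pb : p n.+1 b \in cycles (ses_quot S) n.+1.
    by rewrite cyclesS -cmap_bd bE ses_comp.
  exists (hclass _ _ (Subgroup pb)); apply/esym/snake_fun.
  by exists (Subgroup pb), b, a.
have [c [b [a [_ _ ia <-]]]] := snake_connecting z.
by rewrite hmapE; apply/hclass_eq0; exists b; rewrite -ia.
Qed.

Lemma exact_incl_proj : exact_at (hmap i n) (hmap p n).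
Proof.
move=> y; split=> [|[x <-]]; last first.
  have [a <-] := hclass_surj x; rewrite !hmapE; apply/hclass_eq0; exists 0.
  by rewrite raddf0 /= ses_comp.
have [b <-] := hclass_surj y; rewrite hmapE => /hclass_eq0[c /= cE].
(* Lifting [c] to [b'] and subtracting the boundary of [b'] keeps the class of [b] and makes its
   projection vanish as a chain. *)
have [b' b'c] := ses_surj c.
have : p n (sgval b - bd _ n b') = 0 by rewrite raddfB cmap_bd b'c cE subrr.
move=> /(ses_exact (s := S))[a ia].
have ac : a \in cycles (ses_sub S) n.
  (* [cycles] is defined by cases on the degree: in degree 0 nothing is left to check, and above it
     injectivity of [i] applies. *)
  move: b b' {cE b'c} a ia; case: n => [|m] b b' a ia //.
  rewrite cyclesS; apply/eqP/(@ses_inj S m).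
  rewrite cmap_bd ia raddfB bd_bd subr0 raddf0.
  by apply/eqP; rewrite -cyclesS sgvalP.
exists (hclass (ses_sub S) n (Subgroup ac)).
apply: etrans (hmapE _ _) _; apply/hclass_eq; exists (- b').
by rewrite /= ia raddfN addrAC subrr add0r.
Qed.

Lemma exact_proj_connecting : exact_at (hmap p n.+1) (connecting S n).
Proof.
move=> z; split=> [z0|[x <-]].
  have [c [b [a [cz pb ia]]]] := snake_connecting z.
  rewrite z0 -cz => /hclass_eq0[a' a'a].
  (* Since [a] bounds [a'], both [b] and [i a'] have boundary [i a], so the difference is a cycle;
     it still projects to [c]. *)
  have bc : b - i n.+1 a' \in cycles (ses_tot S) n.+1.
    by rewrite cyclesS raddfB -cmap_bd a'a ia subrr.
  exists (hclass _ _ (Subgroup bc)); rewrite hmapE; congr (hclass _ _ _).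
  by apply: val_inj; rewrite /= raddfB ses_comp subr0.
have [b <-] := hclass_surj x; rewrite hmapE; apply/esym/snake_fun.
(* A class coming from the total complex has a lift that is itself a cycle, so the zigzag ends in
   0. *)
exists (subgroup_map (cmap_cycle p (n := n.+1)) b), (sgval b), 0.
by split; rewrite ?raddf0 //; apply/esym/eqP; rewrite -cyclesS sgvalP.
Qed.

(** In degree 0 every chain is a cycle, so any lift of a representative will do. This is where the
    sequence ends. *)
Lemma hmap_proj0_surj y : exists x, hmap p 0 x = y.
Proof.
have [c <-] := hclass_surj y; have [b pb] := ses_surj (sgval c).
exists (hclass _ 0 (Subgroup (isT : b \in cycles (ses_tot S) 0))).
by rewrite hmapE; congr (hclass _ _ _); apply: val_inj.
Qed.

End LongExactSequence.

(** * Naturality of the connecting homomorphism *)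

Section ConnectingNatural.
Variables (S S' : short_exact).
Variables (fA : chain_map (ses_sub S) (ses_sub S')).
Variables (fB : chain_map (ses_tot S) (ses_tot S')).
Variables (fC : chain_map (ses_quot S) (ses_quot S')).
Hypothesis fAB : forall n x, ses_incl S' n (fA n x) = fB n (ses_incl S n x).
Hypothesis fBC : forall n x, ses_proj S' n (fB n x) = fC n (ses_proj S n x).

(** The chain maps carry a zigzag of [S] to a zigzag of [S'], and a zigzag determines the value of
    the connecting map. *)
Lemma connecting_natural n z :
  connecting S' n (hmap fC n.+1 z) = hmap fA n (connecting S n z).
Proof.
have [c [b [a [cz pb ia <-]]]] := snake_connecting z; rewrite -cz !hmapE.
apply/esym/snake_fun; exists (subgroup_map (cmap_cycle fC (n := n.+1)) c),
  (fB n.+1 b), (subgroup_map (cmap_cycle fA (n := n)) a).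
by split; rewrite //= ?fBC ?pb // fAB ia cmap_bd.
Qed.

End ConnectingNatural.

(** * Elements of directed colimits *)

Section DirectedColimit.
Variables (d : Order.disp_t) (T : porderType d) (M : diagram T).
Hypothesis directed : forall s t : T, exists2 u, (s <= u)%O & (t <= u)%O.

(* For T empty only the first disjunct can hold. *)
Definition from_stage : {pred colim M} :=
  fun z => `[< z = 0 \/ exists t x, colim_in M t x = z >].

Lemma from_stage_zmod_closed : zmod_closed from_stage.
Proof.
split=> [|_ _ /asboolP[->|[s [x <-]]] /asboolP[->|[t [y <-]]]]; apply/asboolP.
- by left.
- by left; rewrite subr0.
- by right; exists t, (- y); rewrite raddfN sub0r.
- by right; exists s, x; rewrite subr0.
- have [u su tu] := directed s t; right; exists u, (tr M su x - tr M tu y).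
  by rewrite raddfB !colim_in_tr.
Qed.
HB.instance Definition _ :=
  GRing.isZmodClosed.Build (colim M) from_stage from_stage_zmod_closed.

Lemma colim_from_stage (z : colim M) :
  z = 0 \/ exists t x, colim_in M t x = z.
Proof.
apply/asboolP; rewrite -[X in is_true X]/(z \in from_stage).
(* Elements coming from a stage form a subgroup by directedness. The projection modulo it kills
   every stage, hence is 0 by the universal property of the colimit. *)
apply/qproj_eq0; move: z.
apply: (@colim_ext _ _ M _ (qproj from_stage) (\0 : {additive _ -> _})) => t x.
by apply/qproj_eq0/asboolP; right; exists t, x.
Qed.

End DirectedColimit.

Lemma below_leE d (T : porderType d) (l : T) (s t : below l) :
  (s <= t)%O = (bval s <= bval t)%O.
Proof. by []. Qed.

Lemma below_directed d (T : orderType d) (l : T) (s t : below l) :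
  exists2 u, (s <= u)%O & (t <= u)%O.
Proof.
by case: (leP (bval s) (bval t)) => [st|/ltW ts]; [exists t|exists s].
Qed.

Lemma left_lim_map_in d (T : porderType d) (M N : diagram T) (f : diagram_map M N)
    (l : T) (t : below l) (x : M (bval t)) :
  left_lim_map f l (colim_in (restrict_below M l) t x) =
  colim_in (restrict_below N l) t (f (bval t) x).
Proof. exact: colim_descE. Qed.

(** * The comparison [kappa] is an isomorphism *)

Section Comparison.
Variables (R : realType) (X : ext_metric R) (n : nat) (l : {nonneg R}).

Lemma kappa_in (t : below l) (x : PH X n (bval t)) :
  kappa X n l (colim_in (restrict_below (PH X n) l) t x) = kappa_stage X n t x.
Proof. exact: colim_descE. Qed.

(** The differential of a subcomplex is restricted from [C], so being a cycle depends on the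
    underlying chain only. This moves a cycle of [F_{<l}] into a stage [F_t]. *)
Lemma sub_cycle (C : complex) (S T : subcomplex C) m
    (x : sub_complex S m) (y : sub_complex T m) :
  sgval x = sgval y ->
  x \in cycles (sub_complex S) m -> y \in cycles (sub_complex T) m.
Proof.
case: m x y => [|m] x y // xy; rewrite !cyclesS => /eqP/(congr1 val) /= bx0.
by apply/eqP/val_inj; rewrite /= -xy bx0.
Qed.

Lemma PH_tr_eq0 (s t : {nonneg R}) (st : (s <= t)%O) (c : subgroup (cycles (FC X s) n))
    (y : normalised X n.+1) :
  y \in filt X t n.+1 -> bd (normalised X) n y = sgval (sgval c) ->
  tr (PH X n) st (hclass (FC X s) n c) = 0.
Proof.
move=> yt yc; apply: etrans (hmapE _ _) _; apply/hclass_eq0.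
by exists (Subgroup yt); apply: val_inj.
Qed.

Lemma kappa_inj : injective (kappa X n l).
Proof.
apply: raddf_inj => z; have [//|[t [h <-]]] := colim_from_stage (@below_directed _ _ l) z.
rewrite kappa_in; have [c <-] := hclass_surj h; rewrite hmapE.
move=> /hclass_eq0[[y yF] /(congr1 val) /= yc].
(* The class dies at any stage [u] past [t] that contains the bounding chain [y]. *)
suff [u tu] : exists2 u : below l, (t <= u)%O & y \in filt X (bval u) n.+1.
  move=> yu; apply: etrans (esym (colim_in_tr (M := restrict_below (PH X n) l) tu _)) _.
  by apply: etrans (congr1 _ (PH_tr_eq0 tu yu yc)) (raddf0 _).
case/filt_lt_chainsP: yF => [->|[s sl ys]]; first by exists t; last exact: rpred0.
have [u tu] := below_directed t (Below sl); rewrite below_leE => su.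
by exists u; last exact: filt_mono su ys.
Qed.

Lemma kappa_surj w : exists z, kappa X n l z = w.
Proof.
have [c <-] := hclass_surj w.
have [c0|[t tl ct]] := (filt_lt_chainsP _ _).1 (sgvalP (sgval c)).
  (* The zero chain need not lie in any stage below [l]: for [l = 0] there is none. *)
  by exists 0; rewrite raddf0 (_ : c = 0) ?raddf0 //; do 2 apply: val_inj.
have cc : (Subgroup ct : FC X t n) \in cycles (FC X t) n.
  exact: (sub_cycle (x := sgval c) (y := Subgroup ct) erefl (sgvalP c)).
exists (colim_in (restrict_below (PH X n) l) (Below tl) (hclass _ _ (Subgroup cc))).
rewrite kappa_in hmapE; congr (hclass _ _ _).
by do 2 apply: val_inj.
Qed.

Definition kappa_inv_fun (w : homology (FltC X l) n) : left_lim (PH X n) l :=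
  projT1 (cid (kappa_surj w)).

Lemma kappa_invK w : kappa X n l (kappa_inv_fun w) = w.
Proof. exact: (projT2 (cid (kappa_surj w))). Qed.

Lemma kappa_bij : bijective (kappa X n l).
Proof.
exists kappa_inv_fun; last exact: kappa_invK.
by move=> z; apply: kappa_inj; rewrite kappa_invK.
Qed.

Lemma kappa_inv_is_additive : zmod_morphism kappa_inv_fun.
Proof. by move=> x y; apply: kappa_inj; rewrite raddfB !kappa_invK. Qed.
HB.instance Definition _ := GRing.isZmodMorphism.Build
  (homology (FltC X l) n) (left_lim (PH X n) l) kappa_inv_fun kappa_inv_is_additive.

(** It suffices to compare on each stage [t < l], where both sides are induced by the inclusion of
    [F_t] in [F_l]. *)
Lemma tau_kappa x : tau X n l x = hmap (ses_incl (magnitude_ses X l)) n (kappa X n l x).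
Proof.
move: x; apply: (@colim_ext _ _ (restrict_below (PH X n) l) _ (tau X n l)
  (hmap (ses_incl (magnitude_ses X l)) n \o kappa X n l)) => t x.
transitivity (from_below (PH X n) t x); first exact: colim_descE.
transitivity (hmap (ses_incl (magnitude_ses X l)) n (kappa_stage X n t x)); last first.
  by apply: (congr1 (hmap _ _)); apply/esym/kappa_in.
by apply: hmap_comp => {}x; apply: val_inj.
Qed.

End Comparison.

Definition FltC_map (R : realType) (X Y : ext_metric R) (f : nonexpansive X Y)
    (l : {nonneg R}) : chain_map (FltC X l) (FltC Y l) :=
  sub_cmap (@normalised_map_filt_lt R X Y f l).

(** * Naturality of the comparison, then of the three maps of the sequence *)

Section KappaNatural.
Variables (R : realType) (X Y : ext_metric R) (f : nonexpansive X Y).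
Variables (n : nat) (l : {nonneg R}).

Lemma kappa_stage_natural (t : below l) (x : PH X n (bval t)) :
  kappa_stage Y n t (PH_map f n (bval t) x) =
  hmap (FltC_map f l) n (kappa_stage X n t x).
Proof.
(* Both sides are induced by this one chain map from [F_t] of [X] to [F_{<l}] of [Y]. *)
pose k := cmap_comp (FltC_map f l)
  (sub_incl (fun m x => @filt_sub_lt R X _ l m x (bvalP t))).
apply: etrans (@hmap_comp _ _ _ _ _ k n (fun=> erefl) x).
by apply/esym/hmap_comp => {}x; apply: val_inj.
Qed.

Lemma kappa_natural_in (t : below l) (x : PH X n (bval t)) :
  kappa Y n l (left_lim_map (PH_map f n) l (colim_in (restrict_below (PH X n) l) t x)) =
  hmap (FltC_map f l) n (kappa X n l (colim_in (restrict_below (PH X n) l) t x)).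
Proof.
have e := congr1 (kappa Y n l) (left_lim_map_in (PH_map f n) x).
have eY := etrans e (kappa_in (PH_map f n (bval t) x)).
have eX := congr1 (hmap (FltC_map f l) n) (kappa_in x).
exact: (etrans eY (etrans (kappa_stage_natural x) (esym eX))).
Qed.

Lemma kappa_natural x :
  kappa Y n l (left_lim_map (PH_map f n) l x) =
  hmap (FltC_map f l) n (kappa X n l x).
Proof.
move: x; apply: (@colim_ext _ _ (restrict_below (PH X n) l) _
  (kappa Y n l \o left_lim_map (PH_map f n) l)
  (hmap (FltC_map f l) n \o kappa X n l)) => t x.
exact: (kappa_natural_in x).
Qed.

End KappaNatural.

Definition delta (R : realType) (l : {nonneg R}) (X : ext_metric R) n :
    {additive MH X n.+1 l -> left_lim (PH X n) l} :=
  @kappa_inv_fun R X n l \o connecting (magnitude_ses X l) n.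

Lemma kappa_delta (R : realType) (l : {nonneg R}) (X : ext_metric R) n z :
  kappa X n l (delta l X n z) = connecting (magnitude_ses X l) n z.
Proof. exact: kappa_invK. Qed.

Section Naturality.
Variables (R : realType) (X Y : ext_metric R) (f : nonexpansive X Y).
Variables (l : {nonneg R}) (n : nat).

Lemma tau_natural x :
  tau Y n l (left_lim_map (PH_map f n) l x) = PH_map f n l (tau X n l x).
Proof.
have eY := tau_kappa (left_lim_map (PH_map f n) l x).
have ef := congr1 (hmap (ses_incl (magnitude_ses Y l)) n) (kappa_natural f x).
have eX := congr1 (PH_map f n l) (tau_kappa x).
apply: etrans (etrans eY ef) (etrans _ (esym eX)).
(* After passing through [kappa], both sides are induced by the map from [F_{<l}] of [X] to [F_l] of
   [Y]. *)
pose h := cmap_comp (FC_map f l) (ses_incl (magnitude_ses X l)).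
apply: etrans _ (@hmap_comp _ _ _ _ _ h n (fun=> erefl) _).
by apply/esym/hmap_comp => y; apply: val_inj.
Qed.

Lemma rho_natural x : rho Y n l (PH_map f n l x) = MH_map f n l (rho X n l x).
Proof.
pose h := cmap_comp (quot_proj (magnitude_subcomplex Y l)) (FC_map f l).
apply: etrans (esym (@hmap_comp _ _ _ _ _ h n (fun=> erefl) x)) _.
by apply: hmap_comp => y; apply/esym/quot_mapE.
Qed.

Lemma connecting_magnitude_natural z :
  connecting (magnitude_ses Y l) n (MH_map f n.+1 l z) =
  hmap (FltC_map f l) n (connecting (magnitude_ses X l) n z).
Proof.
apply: (connecting_natural (S := magnitude_ses X l) (S' := magnitude_ses Y l)
  (fB := FC_map f l)) => m a; first exact: val_inj.
exact/esym/quot_mapE.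
Qed.

End Naturality.

(** * Exactness transported along an isomorphism *)

Section ExactTransport.
Variables (A B C D L : zmodType) (k : {additive L -> A}).
Hypotheses (k_inj : injective k) (k_surj : forall w, exists z, k z = w).
Variables (d : C -> A) (dL : C -> L) (i : A -> B) (iL : L -> B).
Hypotheses (dLE : forall z, k (dL z) = d z) (iLE : forall x, iL x = i (k x)).

Lemma exact_transport_mid : exact_at d i -> exact_at dL iL.
Proof.
move=> di y; rewrite iLE; split=> [/di[z zE]|[z <-]].
  by exists z; apply: k_inj; rewrite dLE.
by apply/di; exists z; rewrite dLE.
Qed.

(** As [k] is onto, [iL] and [i] have the same image. *)
Lemma exact_transport_left (p : B -> D) : exact_at i p -> exact_at iL p.
Proof.
move=> ip y; split=> [/ip[w <-]|[x <-]].
  by have [x <-] := k_surj w; exists x.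
by apply/ip; exists (k x).
Qed.

(** As [k] is additive and injective, [dL] and [d] have the same kernel. *)
Lemma exact_transport_right (p : D -> C) : exact_at p d -> exact_at p dL.
Proof.
move=> pd z; split=> [z0|/pd z0]; last by apply: k_inj; rewrite dLE z0 raddf0.
by apply/pd; rewrite -dLE z0 raddf0.
Qed.

End ExactTransport.

Theorem theorem5p1 (R : realType) (l : {nonneg R}%R) :
  (forall (X : ext_metric R) (n : nat), bijective (kappa X n l)) /\
  exists delta : forall (X : ext_metric R) (n : nat),
      {additive MH X n.+1 l -> left_lim (PH X n) l},
    [/\ forall (X : ext_metric R) (n : nat) z,
          kappa X n l (delta X n z) = connecting (magnitude_ses X l) n z,
        forall (X : ext_metric R) (n : nat),
          [/\ exact_at (delta X n) (tau X n l),
              exact_at (tau X n l) (rho X n l) &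
              exact_at (rho X n.+1 l) (delta X n)],
        forall (X : ext_metric R) (y : MH X 0 l), exists x, rho X 0 l x = y &
        forall (X Y : ext_metric R) (f : nonexpansive X Y) (n : nat),
          [/\ forall x, tau Y n l (left_lim_map (PH_map f n) l x) =
                        PH_map f n l (tau X n l x),
              forall x, rho Y n l (PH_map f n l x) = MH_map f n l (rho X n l x) &
              forall z, delta Y n (MH_map f n.+1 l z) =
                        left_lim_map (PH_map f n) l (delta X n z)]].
Proof.
split=> [X n|]; first exact: kappa_bij.
exists (delta l); split=> [X n z|X n|X y|X Y f n].
- exact: kappa_delta.
- have inj := @kappa_inj R X n l; have surj := @kappa_surj R X n l.
  have tauE := @tau_kappa R X n l; have deltaE := @kappa_delta R l X n.
  have di := @exact_connecting_incl (magnitude_ses X l) n.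
  have ip := @exact_incl_proj (magnitude_ses X l) n.
  have pd := @exact_proj_connecting (magnitude_ses X l) n.
  split.
  + exact (exact_transport_mid inj deltaE tauE di).
  + exact (exact_transport_left surj tauE ip).
  + exact (exact_transport_right inj deltaE pd).
- exact: (@hmap_proj0_surj (magnitude_ses X l)).
- split=> x; [exact: tau_natural|exact: rho_natural|].
  (* Injectivity of [kappa] reduces naturality of [delta] to that of the connecting map and of
     [kappa]. *)
  apply: (@kappa_inj R Y n l).
  have e := etrans (kappa_delta (MH_map f n.+1 l x)) (connecting_magnitude_natural f x).
  have e' := congr1 (hmap (FltC_map f l) n) (kappa_delta x).
  exact (etrans e (esym (etrans (kappa_natural f (delta l X n x)) e'))).
Qed.
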